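(* Let $(X,\le)$ be a finite regular poset of height $n$ with top level $\Omega$. Let $A\subseteq\Omega$ be a $d$-code with $d\in\{1,\ldots,n\}$. Then $$\#A\le\frac{\theta(0)}{\theta(n-d+1)}.$$ Equality holds if and only if $A$ is a Steiner system of strength $n-d+1$.
   Context: Let $(X,\le)$ be a finite poset with bottom element $\bot$. For $a\le b$ in $X$, the length $\ell(a,b)$ is the largest $r$ such that there is a chain $a=x_0<x_1<\cdots<x_r=b$. The height of $a$ is $h(a)=\ell(\bot,a)$, and $n=h(X)=\max_{x\in X}h(x)$ is the height of the poset. The levels are $X_r=\{x\in X: h(x)=r\}$ for $r\in\{0,\ldots,n\}$, and the top level is $\Omega=X_n$. The poset is called regular if the following hold. (R$\theta$) For all $r\in\{0,\ldots,n\}$, the number $\theta(r)=\#\{x\in\Omega: a\le x\}$ is the same for all $a\in X_r$. (R$\mu$) For all $r,s\in\{0,\ldots,n\}$, the number $\mu(r,s)=\#\{x\in X_s: a\le x\le b\}$ is the same for all $(a,b)\in X_r\times\Omega$ with $a\le b$. (R$\nu$) For all $r,s\in\{0,\ldots,n\}$, the number $\nu(r,s)=\#\{x\in X_r: x\le a\}$ is the same for all $a\in X_s$. For $A\subseteq\Omega$ and $x\in X$ put $\lambda^{(A)}(x)=\#\{y\in A: x\le y\}$. The set $A$ is a Steiner system of strength $t\in\{0,\ldots,n\}$ if $\lambda^{(A)}(x)=1$ for all $x\in X_t$. The set $A$ is a $d$-code, for $d\in\{1,\ldots,n\}$, if $\lambda^{(A)}(x)\le 1$ for all $x\in X_{n-d+1}$.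 *)

(* Defs.v *)
From HB Require Import structures.
From mathcomp Require Import all_boot all_order.

Set Implicit Arguments.
Unset Strict Implicit.
Unset Printing Implicit Defensive.

Import Order.TTheory.
Local Open Scope order_scope.

(* A chain a = x_0 < x_1 < ... < x_r = b is represented by the sequence
   x_1, ..., x_r; its r + 1 elements are distinct, so that r < #|X|
   (see chain_length_ub and chain_length_attained).
   The value is only meaningful when a <= b. *)
Definition chain_length (disp : Order.disp_t) (X : finPOrderType disp) (a b : X)
    : nat :=
  \max_(r < #|X| | [exists s : r.-tuple X,
                      path <%O a s && (last a s == b)]) r.

Definition height (disp : Order.disp_t) (X : finBPOrderType disp) (a : X)
    : nat :=
  chain_length \bot a.

Definition poset_height (disp : Order.disp_t) (X : finBPOrderType disp) : nat :=
  \max_(x : X) height x.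
Arguments poset_height {disp} X.

Definition level (disp : Order.disp_t) (X : finBPOrderType disp) (r : nat)
    : {set X} :=
  [set x : X | height x == r].
Arguments level {disp} X r.

Definition top_level (disp : Order.disp_t) (X : finBPOrderType disp)
    : {set X} :=
  level X (poset_height X).
Arguments top_level {disp} X.

Section Regular.
Variables (disp : Order.disp_t) (X : finBPOrderType disp).

Definition regular_theta : Prop :=
  forall r : nat, (r <= poset_height X)%N ->
  forall a a' : X, a \in level X r -> a' \in level X r ->
    #|[set x in top_level X | a <= x]| = #|[set x in top_level X | a' <= x]|.

Definition regular_mu : Prop :=
  forall r s : nat, (r <= poset_height X)%N -> (s <= poset_height X)%N ->
  forall a b a' b' : X,
    a \in level X r -> b \in top_level X -> a <= b ->
    a' \in level X r -> b' \in top_level X -> a' <= b' ->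
    #|[set x in level X s | a <= x <= b]|
      = #|[set x in level X s | a' <= x <= b']|.

Definition regular_nu : Prop :=
  forall r s : nat, (r <= poset_height X)%N -> (s <= poset_height X)%N ->
  forall a a' : X, a \in level X s -> a' \in level X s ->
    #|[set x in level X r | x <= a]| = #|[set x in level X r | x <= a']|.

Definition regular : Prop := [/\ regular_theta, regular_mu & regular_nu].

(* The common value in regular_theta, read off at some element of the level:
   the choice is irrelevant when X is regular, and the default value 0 is never
   used for r <= poset_height X, where the level is nonempty. *)
Definition theta (r : nat) : nat :=
  if [pick a in level X r] is Some a then #|[set x in top_level X | a <= x]|
  else 0%N.

Lemma thetaE r a : regular -> (r <= poset_height X)%N -> a \in level X r ->
  theta r = #|[set x in top_level X | a <= x]|.
Proof.
move=> [hth _ _] hr ha; rewrite /theta; case: pickP => [a' ha'|/(_ a)].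
  exact: hth ha' ha.
by rewrite ha.
Qed.

End Regular.
Arguments regular {disp} X.
Arguments theta {disp} X r.

Section Designs.
Variables (disp : Order.disp_t) (X : finBPOrderType disp) (A : {set X}).

Definition lambda (x : X) : nat := #|[set y in A | x <= y]|.

Definition steiner_system (t : nat) : Prop :=
  forall x : X, x \in level X t -> lambda x = 1%N.

Definition code (d : nat) : Prop :=
  forall x : X, x \in level X (poset_height X - d + 1)%N -> (lambda x <= 1)%N.

End Designs.

Section ChainLengthTheory.
Variables (disp : Order.disp_t) (X : finPOrderType disp).
Implicit Types (a b : X) (s : seq X).

Lemma chain_length_ub a b s : path <%O a s -> last a s = b -> (size s <= chain_length a b)%N.
Proof.
move=> ps ls.
have us : uniq (a :: s) by apply: lt_sorted_uniq.
have hs : (size s < #|X|)%N by have := max_card (mem (a :: s)); rewrite (card_uniqP us).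
apply: (@leq_bigmax_cond _ _ (fun i : 'I_#|X| => i : nat) (Ordinal hs)) => /=.
by apply/existsP; exists (in_tuple s); rewrite /= ps ls eqxx.
Qed.

Lemma chain_length_attained a b : a <= b ->
  exists s, [/\ path <%O a s, last a s = b & size s = chain_length a b].
Proof.
move=> le_ab.
pose P (r : 'I_#|X|) :=
  [exists s : r.-tuple X, path <%O a s && (last a s == b)].
have hP s : path <%O a s -> last a s = b -> (0 < #|P|)%N.
  move=> ps ls; have us : uniq (a :: s) by apply: lt_sorted_uniq.
  have hs : (size s < #|X|)%N.
    by have := max_card (mem (a :: s)); rewrite (card_uniqP us).
  apply/card_gt0P; exists (Ordinal hs); rewrite unfold_in /P /=.
  by apply/existsP; exists (in_tuple s); rewrite /= ps ls eqxx.
have P0 : (0 < #|P|)%N.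
  case: (eqVneq a b) => [eab|nab]; first exact: (hP [::]).
  by apply: (hP [:: b]) => //=; rewrite lt_neqAle nab le_ab.
have [r] := eq_bigmax_cond (fun i : 'I_#|X| => i : nat) P0.
rewrite unfold_in => /existsP[s /andP[ps /eqP ls]] er.
by exists s; split=> //; rewrite size_tuple; apply: esym; exact: er.
Qed.

End ChainLengthTheory.

(* Main.v *)
Require Import Defs.
From mathcomp Require Import all_boot all_order all_algebra.

Set Implicit Arguments.
Unset Strict Implicit.
Unset Printing Implicit Defensive.

Import Order.TTheory GRing.Theory Num.Theory.
Local Open Scope ring_scope.

(** Put [t = n - d + 1] and let [N > 0] be the number of elements of level [t]
    below a point of the top level, which is the same for all such points by
    (R nu). Counting the pairs [x <= y] with [x] of level [t] in two ways
    ([sum_lambda]) gives, for any set [B] of top points,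
      [#|B| * N = \sum_(x in level X t) lambda B x].
    If [B] is the code [A], each summand is at most 1, so
    [#|A| * N <= #|level X t|], with equality exactly when every summand is 1,
    that is, when [A] is a Steiner system. If [B] is the whole top level, each
    summand is [theta X t] and [#|B| = theta X 0], so
    [theta X 0 * N = #|level X t| * theta X t]. Multiplying the inequality by
    [theta X t] and cancelling [N] gives [#|A| * theta X t <= theta X 0]
    with the same equality case ([code_card_leqif]).

    Cancelling [N] and dividing by [theta X t] require both to be nonzero. This
    holds because a longest chain from the bottom to a top point passes through
    every level ([level_below]). *)

Section Heights.
Variables (disp : Order.disp_t) (X : finBPOrderType disp).
Implicit Types (a b x : X).
Local Open Scope order_scope.

Lemma path_lt_le_last a s : path <%O a s -> a <= last a s.
Proof.
elim: s a => //= b s IHs a /andP[lt_ab /IHs].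
exact/le_trans/ltW.
Qed.

Lemma height_bot : height (\bot : X) = 0%N.
Proof.
have [s [ps ls sz_s]] := chain_length_attained (lexx (\bot : X)).
rewrite /height -sz_s; case: s ps ls {sz_s} => //= b s /andP[lt_b ps] ls.
by have := lt_le_trans lt_b (path_lt_le_last ps); rewrite ls ltxx.
Qed.

Lemma top_level_ex : exists b, b \in top_level X.
Proof.
have [|b hb] := @bigop.eq_bigmax X (@height disp X); first by apply/card_gt0P; exists \bot.
by exists b; rewrite inE -hb.
Qed.

(** The [t]-th point of a longest chain from the bottom to [b] has height
    exactly [t]: a longer chain to it could be prolonged by the remaining points
    to a chain to [b] of more than [height b] steps. *)
Lemma level_below b t : (t <= height b)%N ->
  exists2 x, x \in level X t & x <= b.
Proof.
move=> le_t; have [s [ps ls sz_s]] := chain_length_attained (le0x b).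
rewrite -/(height b) in sz_s.
set x := last \bot (take t s).
have := ps; rewrite -{1}(cat_take_drop t s) cat_path -/x => /andP[p_take p_drop].
have last_drop : last x (drop t s) = b.
  by rewrite /x -last_cat cat_take_drop.
exists x; last by rewrite -last_drop path_lt_le_last.
have ge_t : (t <= height x)%N.
  by have := chain_length_ub p_take (erefl x); rewrite size_takel ?sz_s.
have [s' [ps' ls' sz_s']] := chain_length_attained (le0x x).
have long : (height x + (height b - t) <= height b)%N.
  have -> : (height x + (height b - t) = size (s' ++ drop t s))%N.
    by rewrite size_cat size_drop sz_s sz_s'.
  by apply: chain_length_ub; rewrite ?cat_path ?last_cat ls' ?ps'.
rewrite inE eqn_leq ge_t andbT.
by rewrite -(leq_add2r (height b - t)) subnKC.
Qed.

End Heights.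

Section Counting.
Variables (disp : Order.disp_t) (X : finBPOrderType disp).
Implicit Types (A B : {set X}) (t : nat).

Lemma sum_lambda B (S : {set X}) :
  (\sum_(x in S) lambda B x = \sum_(y in B) #|[set x in S | (x <= y)%O]|)%N.
Proof.
have cardE (C : {set X}) (P : pred X) :
    (#|[set z in C | P z]| = \sum_(z in C) P z)%N.
  rewrite -sum1_card big_mkcond [RHS]big_mkcond; apply: eq_bigr => z _.
  by rewrite inE; case: (z \in C); case: (P z).
rewrite (eq_bigr _ (fun x _ => cardE B (fun y => (x <= y)%O))) exchange_big /=.
by apply: eq_bigr => y _; rewrite cardE.
Qed.

Lemma theta_gt0 t : regular X -> (t <= poset_height X)%N -> (0 < theta X t)%N.
Proof.
move=> hX le_t; have [b hb] := top_level_ex X.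
have [|a ha le_ab] := @level_below _ X b t.
  by move: hb; rewrite inE => /eqP ->.
by rewrite (thetaE hX le_t ha); apply/card_gt0P; exists b; rewrite inE hb.
Qed.

Lemma theta0 : regular X -> theta X 0 = #|top_level X|.
Proof.
move=> hX; rewrite (@thetaE _ _ _ \bot%O) ?inE ?height_bot //.
by apply: eq_card => y; rewrite inE le0x andbT.
Qed.

Lemma code_card_leqif A t : regular X -> (t <= poset_height X)%N ->
  A \subset top_level X ->
  (forall x, x \in level X t -> (lambda A x <= 1)%N) ->
  (#|A| * theta X t <= theta X 0
     ?= iff [forall x in level X t, lambda A x == 1%N])%N.
Proof.
move=> hX le_t hA hcode; have [b hb] := top_level_ex X.
pose N := #|[set x in level X t | (x <= b)%O]|.
have N_gt0 : (0 < N)%N.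
  have [|x hx le_xb] := @level_below _ X b t.
    by move: hb; rewrite inE => /eqP ->.
  by apply/card_gt0P; exists x; rewrite inE hx.
have count B : B \subset top_level X ->
    (\sum_(x in level X t) lambda B x = #|B| * N)%N.
  move=> /subsetP hB; rewrite sum_lambda -sum_nat_const.
  apply: eq_bigr => y /hB hy.
  by have [_ _ hnu] := hX; apply: (hnu _ (poset_height X)).
have count_top : (theta X 0 * N = #|level X t| * theta X t)%N.
  rewrite theta0 // -count // -sum_nat_const.
  by apply: eq_bigr => x hx; rewrite (thetaE hX le_t hx).
have : (#|A| * N <= #|level X t|
     ?= iff [forall x in level X t, lambda A x == 1%N])%N.
  rewrite -count // -[#|level X t|]sum1_card.
  by apply: leqif_sum => x hx; split; first exact: hcode.
case=> le_N eq_N; have th_gt0 := theta_gt0 hX le_t.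
split; first by rewrite -(leq_pmul2r N_gt0) count_top mulnAC leq_pmul2r.
by rewrite -(eqn_pmul2r N_gt0) count_top mulnAC eqn_pmul2r.
Qed.

End Counting.

Theorem theorem4 (disp : Order.disp_t) (X : finBPOrderType disp) (n d : nat)
    (A : {set X}) (hn : poset_height X = n) (hX : regular X)
    (hA : A \subset top_level X) (hd : (1 <= d <= n)%N) (hcode : code A d) :
  (#|A|%:R <= (theta X 0)%:R / (theta X (n - d + 1)%N)%:R :> rat)
  /\ (#|A|%:R = (theta X 0)%:R / (theta X (n - d + 1)%N)%:R :> rat
      <-> steiner_system A (n - d + 1)%N).
Proof.
have le_t : (n - d + 1 <= poset_height X)%N.
  by have /andP[d_gt0 le_dn] := hd; rewrite hn addn1 ltn_subrL d_gt0 (leq_trans d_gt0).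
move: hcode; rewrite /code hn => hcode.
have [le_A eq_A] := code_card_leqif hX le_t hA hcode.
have th_gt0 : 0 < (theta X (n - d + 1)%N)%:R :> rat by rewrite ltr0n theta_gt0.
split; first by rewrite ler_pdivlMr // -natrM ler_nat.
have eqE : (#|A|%:R == (theta X 0)%:R / (theta X (n - d + 1)%N)%:R :> rat)
    = [forall x in level X (n - d + 1)%N, lambda A x == 1%N].
  have th_neq0 := lt0r_neq0 th_gt0.
  by rewrite -eq_A -(eqr_nat rat) natrM -(inj_eq (mulIf th_neq0)) divfK.
split=> [/eqP|st]; first by rewrite eqE => /forall_inP h x hx; exact/eqP/h.
by apply/eqP; rewrite eqE; apply/forall_inP => x hx; apply/eqP/st.
Qed.
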